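(* Assume each $f_i$ is strongly convex with constant $\mu_i>0$ and differentiable, $i=1,\dots,m$. Assume that the optimal values of the primal problem (P) and the dual problem (D) are attained, at $\mathbf{y}^\star$ and $\boldsymbol{\lambda}^\star$ respectively, and that strong duality $f(\mathbf{y}^\star)=g(\boldsymbol{\lambda}^\star)$ holds. Let $\mu=\min_i\mu_i$, $L_h=(1/\mu)(2+2\cos(\pi/m))$, $S=\sqrt{(4+4\cos(\pi/m))/\mu}$. Let $\{\boldsymbol{\lambda}^{(k)}\}_{k\ge 0}$ and $\{\mathbf{y}^{(k)}\}_{k\ge0}$ be the sequences of Lagrange multipliers and primal variables generated by the inexact dual algorithm with distortions satisfying $\|\mathbf{r}_i^{(k)}\|\le\varepsilon_i$ for all $i,k$, and with stepsizes satisfying $0<\gamma_k\le 1/L_h$ for all $k$ and $\sum_{k=0}^\infty\gamma_k=\infty$. Suppose there is a scalar $D$ such that $\|\boldsymbol{\lambda}^{(k)}-\boldsymbol{\lambda}^\star\|\le D$ for all $k$. Then: 1. $\displaystyle\limsup_{k}\ \min_{i\in\{0,\dots,k\}}\|\mathbf{y}^{(i)}-\mathbf{y}^\star\|\le\sqrt{2D\epsilon/\mu}$. 2. $\displaystyle\limsup_{k}\ \min_{i\in\{0,\dots,k\}}\big(f(\mathbf{y}^{(i)})-f(\mathbf{y}^\star)\big)\le D\epsilon+\sqrt{D}\,S\,(D+\|\boldsymbol{\lambda}^\star\|)\sqrt{\epsilon}$. 3. If $\gamma_k=\gamma/(k+1)^p$ with $0<\gamma\le1/L_h$ and $0\le p\le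 1$, then there is a constant $C$ (independent of $k$) such that for all sufficiently large $k$, $$\min_{i\in\{0,\dots,k\}}\|\mathbf{y}^{(i)}-\mathbf{y}^\star\|\le C\,a_k+\sqrt{2D\epsilon/\mu},$$ where $a_k=1/\sqrt[4]{k^{1-p}}$ if $p\in[0,1)$ and $a_k=1/\sqrt[4]{\log k}$ if $p=1$. Among these bounds the best order is $O(1/\sqrt[4]{k})$, achieved when $p=0$. 4. If $\gamma_k=\gamma/(k+1)^p$ with $0<\gamma\le1/L_h$ and $0\le p\le 1$, then there is a constant $C$ (independent of $k$) such that for all sufficiently large $k$, $$\min_{i\in\{0,\dots,k\}}\big|f(\mathbf{y}^{(i)})-f(\mathbf{y}^\star)\big|\le C\,a_k+D\epsilon+\sqrt{D}\,S\,(D+\|\boldsymbol{\lambda}^\star\|)\sqrt{\epsilon},$$ with $a_k$ as defined in item 3. Among these bounds the best order is $O(1/\sqrt[4]{k})$, achieved when $p=0$.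
   Context: Let $m\ge2$, $n\ge1$ be integers, $\mathcal{Y}\subseteq\mathbb{R}^n$ a closed convex set, and $f_i:\mathbb{R}^n\to\mathbb{R}$, $i=1,\dots,m$, strictly convex closed functions. For $\mathbf{y}=(\mathbf{y}_1,\dots,\mathbf{y}_m)\in(\mathbb{R}^n)^m=\mathbb{R}^{nm}$ put $f(\mathbf{y})=\sum_{i=1}^m f_i(\mathbf{y}_i)$, and let $\bar{\mathcal{Y}}=\mathcal{Y}^m$. Let $\mathbf{A}\in\mathbb{R}^{n(m-1)\times nm}$ be the linear map $\mathbf{A}\mathbf{y}=(\mathbf{y}_1-\mathbf{y}_2,\dots,\mathbf{y}_{m-1}-\mathbf{y}_m)$. Primal problem (P): minimize $f(\mathbf{y})$ subject to $\mathbf{y}\in\bar{\mathcal{Y}}$, $\mathbf{A}\mathbf{y}=\mathbf{0}$. Dual function: $g(\boldsymbol{\lambda})=\inf_{\mathbf{y}\in\bar{\mathcal{Y}}}\big[f(\mathbf{y})+\boldsymbol{\lambda}^{T}\mathbf{A}\mathbf{y}\big]$ for $\boldsymbol{\lambda}\in\mathbb{R}^{n(m-1)}$. Dual problem (D): maximize $g(\boldsymbol{\lambda})$ over $\boldsymbol{\lambda}\in\mathbb{R}^{n(m-1)}$. Inexact dual algorithm: start from any $\boldsymbol{\lambda}^{(0)}\in\mathbb{R}^{n(m-1)}$; for $k=0,1,2,\dots$ let $\mathbf{y}^{(k)}=\arg\min_{\mathbf{y}\in\bar{\mathcal{Y}}}\big[f(\mathbf{y})+(\boldsymbol{\lambda}^{(k)})^{T}\mathbf{A}\mathbf{y}\big]$,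 let $\hat{\mathbf{y}}_i^{(k)}=\mathbf{y}_i^{(k)}+\mathbf{r}_i^{(k)}$ where $\mathbf{r}_i^{(k)}\in\mathbb{R}^n$ are arbitrary distortions, let $\hat{\mathbf{d}}^{(k)}=\mathbf{A}\hat{\mathbf{y}}^{(k)}$, and set $\boldsymbol{\lambda}^{(k+1)}=\boldsymbol{\lambda}^{(k)}+\gamma_k\hat{\mathbf{d}}^{(k)}$, with stepsize $\gamma_k>0$. The distortions are bounded by constants: $\|\mathbf{r}_i^{(k)}\|\le\varepsilon_i$ for all $i$ and $k$, and $\epsilon:=\sqrt{\sum_{i=1}^{m-1}(\varepsilon_i+\varepsilon_{i+1})^2}$. Norms are Euclidean. A function $\varphi$ is strongly convex with constant $\sigma>0$ if $\varphi-\frac{\sigma}{2}\|\cdot\|^2$ is convex. *)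

(* Defs.v *)
From HB Require Import structures.
From mathcomp Require Import all_boot all_order all_algebra.
From mathcomp Require Import all_classical all_reals all_analysis.

Set Implicit Arguments.
Unset Strict Implicit.
Unset Printing Implicit Defensive.

Import Order.TTheory GRing.Theory Num.Theory.
Import numFieldNormedType.Exports.

Local Open Scope classical_set_scope.
Local Open Scope ring_scope.

(* A block vector (x_1, ..., x_p) of (R^n)^p is the matrix in 'M[R]_(p, n)
   whose rows are the x_i. *)

(* The library norm `|M| on matrices is the sup norm, so the Euclidean norm and
   inner product of R^(p * n) are defined here; the topology is the same. *)
Definition edot (R : realType) (p n : nat) (u v : 'M[R]_(p, n)) : R :=
  \sum_i \sum_j u i j * v i j.

Definition enorm (R : realType) (p n : nat) (u : 'M[R]_(p, n)) : R :=
  Num.sqrt (edot u u).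

Section Convexity.
Variables (R : realType) (n : nat).
Implicit Types (f : 'rV[R]_n -> R) (sigma : R).

Definition strictly_convex f : Prop :=
  forall (x y : 'rV[R]_n) (t : R), x <> y -> 0 < t < 1 ->
    f (t *: x + (1 - t) *: y) < t * f x + (1 - t) * f y.

Definition closed_function f : Prop :=
  closed [set p : 'rV[R]_n * R | f p.1 <= p.2].

Definition strongly_convex sigma f : Prop :=
  0 < sigma /\
  convex_function setT (fun x : 'rV[R]_n => f x - sigma / 2 * enorm x ^+ 2).

End Convexity.

(* For i : 'I_m.-1, the indices i and i + 1 as elements of 'I_m. *)
Definition ord_fst (m : nat) (i : 'I_m.-1) : 'I_m :=
  widen_ord (leq_pred m) i.

Lemma ord_snd_subproof (m : nat) (i : 'I_m.-1) : (i.+1 < m)%N.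
Proof. by rewrite -ltn_predRL. Qed.

Definition ord_snd (m : nat) (i : 'I_m.-1) : 'I_m :=
  Ordinal (ord_snd_subproof i).

Section Problem.
Variables (R : realType) (m n : nat).
Variables (Y : set 'rV[R]_n) (f : 'I_m -> 'rV[R]_n -> R).
Implicit Types (y : 'M[R]_(m, n)) (lam : 'M[R]_(m.-1, n)).

Definition fsum y : R := \sum_i f i (row i y).

Definition Ybar : set 'M[R]_(m, n) := [set y | forall i, Y (row i y)].

Definition Amap y : 'M[R]_(m.-1, n) :=
  \matrix_(i < m.-1) (row (ord_fst i) y - row (ord_snd i) y).

Definition lagrangian lam y : R := fsum y + edot lam (Amap y).

Definition dual_fun lam : \bar R :=
  ereal_inf [set (lagrangian lam y)%:E | y in Ybar].

Definition primal_feasible y : Prop := Ybar y /\ Amap y = 0.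

Definition primal_optimal y : Prop :=
  primal_feasible y /\ forall z, primal_feasible z -> fsum y <= fsum z.

Definition dual_optimal lam : Prop :=
  forall nu, (dual_fun nu <= dual_fun lam)%E.

Definition is_argmin (T : Type) (D : set T) (h : T -> R) (x : T) : Prop :=
  D x /\ forall z, D z -> h x <= h z.

Definition inexact_dual_algorithm (gamma : nat -> R) (r : nat -> 'M[R]_(m, n))
    (lam : nat -> 'M[R]_(m.-1, n)) (y : nat -> 'M[R]_(m, n)) : Prop :=
  forall k, is_argmin Ybar (lagrangian (lam k)) (y k) /\
    lam k.+1 = lam k + gamma k *: Amap (y k + r k).

End Problem.

Section Constants.
Variables (R : realType) (m : nat).

Definition mu_min (hm : (2 <= m)%N) (mu : 'I_m -> R) : R :=
  \big[Num.min/mu (Ordinal (ltnW hm))]_i mu i.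

Definition Lh (mu : R) : R := 1 / mu * (2 + 2 * cos (pi / m%:R)).

Definition Sconst (mu : R) : R := Num.sqrt ((4 + 4 * cos (pi / m%:R)) / mu).

Definition total_eps (eps : 'I_m -> R) : R :=
  Num.sqrt (\sum_(i < m.-1) (eps (ord_fst i) + eps (ord_snd i)) ^+ 2).

End Constants.

Definition running_min (R : realType) (u : nat -> R) (k : nat) : R :=
  \big[Num.min/u 0%N]_(i < k.+1) u i.

Definition root4 (R : realType) (x : R) : R := x `^ 4^-1.

Definition rate (R : realType) (p : R) (k : nat) : R^o :=
  if p < 1 then 1 / root4 (k%:R `^ (1 - p)) else 1 / root4 (ln k%:R).

Definition quartic_rate (R : realType) (k : nat) : R^o := 1 / root4 k%:R.

(* "Among the orders [rate p], 0 <= p <= 1, the best is O(1 / k^(1/4)), achieved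
   when p = 0": no [rate p] has a smaller order than [quartic_rate], and the
   order of [quartic_rate] is reached exactly at p = 0. *)
Definition best_order_at_0 (R : realType) : Prop :=
  forall p : R, 0 <= p <= 1 ->
    @quartic_rate R =O_\oo rate p /\ (rate p =O_\oo @quartic_rate R <-> p = 0).

(* Main.v *)
(* Strong convexity makes the Lagrangian grow quadratically around its minimizer,
   which bounds |y_k - y_star|^2 by 2/mu times the duality gap g_star - g(lam_k),
   and makes -g smooth with constant |A|^2/mu; here |A|^2 = 2 + 2 cos(pi/m) is
   the top eigenvalue of the Laplacian of the path with m vertices. The standard
   estimate for gradient ascent, with the distortion A r_k of the gradient kept
   as an error term, telescopes |lam_k - lam_star|^2 and yields
     min_{i <= k} gap_i <= D epsilon + D^2 / (2 sum_{j < k} gamma_j).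
   The error in the objective is controlled by the gap because
   f(y_k) - f_star = - gap_k - <lam_k, A (y_k - y_star)>. *)
Require Import Defs.
From HB Require Import structures.
From mathcomp Require Import all_boot all_order all_algebra.
From mathcomp Require Import all_classical all_reals all_analysis.
From mathcomp Require Import ring lra.

Set Implicit Arguments.
Unset Strict Implicit.
Unset Printing Implicit Defensive.

Import Order.TTheory GRing.Theory Num.Theory.
Import numFieldNormedType.Exports.

Local Open Scope classical_set_scope.
Local Open Scope ring_scope.

(** * Euclidean inner product and norm of block vectors *)

Section Euclidean.
Variables (R : realType) (p n : nat).
Implicit Types (u v w : 'M[R]_(p, n)) (a t : R).

Lemma edotC u v : edot u v = edot v u.
Proof. by apply: eq_bigr => i _; apply: eq_bigr => j _; rewrite mulrC. Qed.

Lemma edotDl u v w : edot (u + v) w = edot u w + edot v w.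
Proof.
rewrite /edot -big_split; apply: eq_bigr => i _ /=.
by rewrite -big_split; apply: eq_bigr => j _; rewrite /= mxE mulrDl.
Qed.

Lemma edotZl a u v : edot (a *: u) v = a * edot u v.
Proof.
rewrite /edot mulr_sumr; apply: eq_bigr => i _.
by rewrite mulr_sumr; apply: eq_bigr => j _; rewrite mxE mulrA.
Qed.

Lemma edotDr u v w : edot u (v + w) = edot u v + edot u w.
Proof. by rewrite edotC edotDl !(edotC _ u). Qed.

Lemma edotZr a u v : edot u (a *: v) = a * edot u v.
Proof. by rewrite edotC edotZl edotC. Qed.

Lemma edotNl u v : edot (- u) v = - edot u v.
Proof. by rewrite -scaleN1r edotZl mulN1r. Qed.

Lemma edotNr u v : edot u (- v) = - edot u v.
Proof. by rewrite edotC edotNl edotC. Qed.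

Lemma edot0r u : edot u 0 = 0.
Proof. by rewrite -(scale0r 0) edotZr mul0r. Qed.

Definition edotE := (edotDl, edotDr, edotNl, edotNr, edotZl, edotZr).

Lemma edot_ge0 u : 0 <= edot u u.
Proof. by do 2!apply: sumr_ge0 => ? _; rewrite -expr2 sqr_ge0. Qed.

Lemma enorm_ge0 u : 0 <= enorm u.
Proof. exact: sqrtr_ge0. Qed.

Lemma sqr_enorm u : enorm u ^+ 2 = edot u u.
Proof. by rewrite sqr_sqrtr ?edot_ge0. Qed.

(** Cauchy-Schwarz, from the nonnegative square of [edot v v *: u - edot u v *: v] when [edot v v]
    is nonzero. *)
Lemma sqr_edot_le u v : edot u v ^+ 2 <= edot u u * edot v v.
Proof.
have [v0|v0] := eqVneq (edot v v) 0.
  rewrite v0 mulr0; have [->|q0] := eqVneq (edot u v) 0; first by rewrite expr0n.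
  (* This multiplier of [v] makes the expanded square equal to -1, a contradiction. *)
  have := edot_ge0 (u - ((edot u u + 1) / (2 * edot u v)) *: v).
  rewrite !edotE (edotC v u) v0.
  have -> : (edot u u + 1) / (2 * edot u v) * edot u v = (edot u u + 1) / 2.
    by field.
  lra.
have vp : 0 < edot v v by rewrite lt_def v0 edot_ge0.
have := edot_ge0 (edot v v *: u - edot u v *: v).
rewrite !edotE (edotC v u) => h; rewrite -subr_ge0 -(pmulr_rge0 _ vp).
by move: h; nra.
Qed.

Lemma edot_le_enorm u v : `|edot u v| <= enorm u * enorm v.
Proof.
rewrite -[leLHS]ger0_norm// -[leRHS]ger0_norm ?mulr_ge0 ?enorm_ge0//.
by rewrite -ler_sqr ?nnegrE// !real_normK ?num_real// exprMn !sqr_enorm sqr_edot_le.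
Qed.

Lemma enormD_le u v : enorm (u + v) <= enorm u + enorm v.
Proof.
rewrite -ler_sqr ?nnegrE ?addr_ge0 ?enorm_ge0// sqrrD !sqr_enorm !edotE.
by have := le_trans (ler_norm _) (edot_le_enorm u v); rewrite (edotC v u); lra.
Qed.

Lemma enormN u : enorm (- u) = enorm u.
Proof. by rewrite /enorm !edotE opprK. Qed.

Lemma edot_conv t u v :
  edot (t *: u + (1 - t) *: v) (t *: u + (1 - t) *: v) =
  t * edot u u + (1 - t) * edot v v - t * (1 - t) * edot (u - v) (u - v).
Proof. by rewrite !edotE (edotC v u); ring. Qed.

Lemma edot_rows u v : edot u v = \sum_i edot (row i u) (row i v).
Proof.
apply: eq_bigr => i _; rewrite /edot big_ord1.
by apply: eq_bigr => j _; rewrite !mxE.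
Qed.

End Euclidean.

(** The quadratic defect is the one that [edot_conv] computes for the squared norm. *)
Lemma strongly_convexW (R : realType) (n : nat) (sigma : R) (f : 'rV[R]_n -> R) :
  strongly_convex sigma f -> forall (x y : 'rV[R]_n) (t : R), 0 <= t <= 1 ->
  f (t *: x + (1 - t) *: y) <=
    t * f x + (1 - t) * f y - sigma / 2 * (t * (1 - t) * edot (x - y) (x - y)).
Proof.
move=> [_ cf] x y t /andP[t0 t1].
have := cf (Itv01 t0 t1) x y; rewrite !inE => /(_ I I).
rewrite convRE /= /conv /= /unstable.onem !sqr_enorm edot_conv; lra.
Qed.

(** * Norm of the map A through the path Laplacian *)

Section PathGraph.
Variable R : realType.

Section scalar.
Variables (c : R) (w v : nat -> R) (N : nat).
Hypothesis w_gt0 : forall i, (i <= N)%N -> 0 < w i.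
Hypothesis wS : forall i, w i.+2 + w i = (c - 2) * w i.+1.
Hypothesis w1 : w 1 = (c - 1) * w 0.

(* Weighted AM-GM on each edge: the weights satisfy the eigenvector equation of the
   path Laplacian (up to alternating signs), so the coefficients add up to [c]. *)
Lemma sum_sqr_diff_le (k : nat) : (k <= N)%N ->
  \sum_(i < k) (v i - v i.+1) ^+ 2 + (1 + w k.+1 / w k) * v k ^+ 2
    <= c * \sum_(i < k.+1) v i ^+ 2.
Proof.
elim: k => [|k IH] kN.
  have w0 := lt0r_neq0 (w_gt0 kN); rewrite big_ord0 big_ord1 w1 mulfK//.
  by move: (v _) => x; lra.
have {}IH := IH (ltnW kN).
have wk := w_gt0 (ltnW kN); have wk1 := w_gt0 kN.
rewrite big_ord_recr [in leRHS]big_ord_recr /=.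
have -> : w k.+2 = (c - 2) * w k.+1 - w k by rewrite -wS addrK.
have wk' := lt0r_neq0 wk; have wk1' := lt0r_neq0 wk1.
rewrite mulrBl mulfK//.
move: IH; set A := \sum_(i < k) _; set B := \sum_(i < k.+1) _ => IH.
have : 0 <= (w k.+1 * v k + w k * v k.+1) ^+ 2 / (w k * w k.+1).
  by rewrite divr_ge0 ?sqr_ge0// mulr_ge0 ?ltW.
have -> : (w k.+1 * v k + w k * v k.+1) ^+ 2 / (w k * w k.+1) =
  w k.+1 / w k * v k ^+ 2 + w k / w k.+1 * v k.+1 ^+ 2 + 2 * v k * v k.+1.
  by field; apply/andP.
lra.
Qed.

End scalar.

(** With x = (i + 1/2) t this is the three-term recurrence required of the sine weights. *)
Lemma sinD_step (x t : R) : sin (x + t + t) + sin x = 2 * cos t * sin (x + t).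
Proof.
rewrite !(sinD, cosD).
have : sin x * (cos t ^+ 2 + sin t ^+ 2) = sin x by rewrite cos2Dsin2 mulr1.
lra.
Qed.

(* Taken with the weights [sin ((i + 1/2) pi / m)]. *)
Lemma sum_sqr_diff_cos (m : nat) (v : nat -> R) : (0 < m)%N ->
  \sum_(i < m.-1) (v i - v i.+1) ^+ 2
    <= (2 + 2 * cos (pi / m%:R)) * \sum_(i < m) v i ^+ 2.
Proof.
case: m => // N _; rewrite /=; set th : R := pi / N.+1%:R.
have hth : N.+1%:R * th = pi by rewrite /th mulrC divfK.
have th0 : 0 < th by rewrite divr_gt0 ?pi_gt0 ?ltr0n.
pose w i := sin (i%:R * th + th / 2).
have := @sum_sqr_diff_le (2 + 2 * cos th) w v N _ _ _ N (leqnn _).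
(* These weights are sin(pi + th/2) and sin(pi - th/2), so the boundary coefficient 1 + w_{N+1}/w_N
   vanishes. *)
have -> : w N.+1 = - w N.
  have -> : w N.+1 = - sin (th / 2) by rewrite /w hth addrC sinDpi.
  have -> : w N = - sin (- (th / 2)); last by rewrite sinN !opprK.
  rewrite -sinDpi /w -hth; congr sin; rewrite -natr1; by field.
have wgt0 i : (i <= N)%N -> 0 < w i.
  move=> iN; apply: sin_gt0_pi; apply/andP; split.
    by have := mulr_ge0 (ler0n R i) (ltW th0); lra.
  rewrite -hth -[N.+1%:R]natr1 mulrDl mul1r ler_ltD//; last by lra.
  by rewrite ler_pM2r// ler_nat.
rewrite mulNr divff ?lt0r_neq0 ?wgt0// subrr mul0r addr0; apply => // [i|].
  have -> : w i.+2 = sin (i%:R * th + th / 2 + th + th).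
    by rewrite /w -[i.+2%:R]natr1 -[i.+1%:R]natr1; congr sin; ring.
  have -> : w i.+1 = sin (i%:R * th + th / 2 + th).
    by rewrite /w -[i.+1%:R]natr1; congr sin; ring.
  by rewrite /w sinD_step; congr (_ * _); ring.
(* The recurrence at index -1, where the weight is [- w 0] by oddness, gives the initial condition
   on [w 1]. *)
have := sinD_step (- (th / 2)) th.
have -> : - (th / 2) + th = th / 2 by field.
have -> : w 1 = sin (th / 2 + th) by rewrite /w mul1r addrC.
by rewrite sinN /w mul0r add0r; lra.
Qed.

Lemma AmapD (m n : nat) (u v : 'M[R]_(m, n)) : Amap (u + v) = Amap u + Amap v.
Proof. by apply/matrixP => i j; rewrite !mxE; ring. Qed.

Lemma AmapZ (m n : nat) (a : R) (u : 'M[R]_(m, n)) : Amap (a *: u) = a *: Amap u.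
Proof. by apply/matrixP => i j; rewrite !mxE; ring. Qed.

Lemma AmapN (m n : nat) (u : 'M[R]_(m, n)) : Amap (- u) = - Amap u.
Proof. by apply/matrixP => i j; rewrite !mxE; ring. Qed.

(** A acts on each coordinate separately, so the scalar inequality is applied column by column. *)
Lemma Amap_edot_le (m n : nat) (u : 'M[R]_(m, n)) : (0 < m)%N ->
  edot (Amap u) (Amap u) <= (2 + 2 * cos (pi / m%:R)) * edot u u.
Proof.
move=> m0; rewrite /edot exchange_big [in leRHS]exchange_big /= mulr_sumr.
apply: ler_sum => j _; case: m m0 u => // m _ u.
have := @sum_sqr_diff_cos m.+1 (fun i => u (inord i) j) isT.
congr (_ <= _).
  apply: eq_bigr => i _; rewrite !mxE -expr2; congr ((u _ j - u _ j) ^+ 2);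
  by apply: val_inj; rewrite /= inordK ?ltnS ?ltn_ord ?(ltnW (ltn_ord i)).
by congr (_ * _); apply: eq_bigr => i _; rewrite inord_val expr2.
Qed.

(** Each block of A u is a difference of consecutive rows, bounded by the triangle inequality. *)
Lemma Amap_enorm_le (m n : nat) (u : 'M[R]_(m, n)) (eps : 'I_m -> R) :
  (forall i, enorm (row i u) <= eps i) -> enorm (Amap u) <= total_eps eps.
Proof.
move=> ue; apply: ler_wsqrtr; rewrite edot_rows.
apply: ler_sum => i _; rewrite rowK -sqr_enorm ler_sqr ?nnegrE ?enorm_ge0//.
  by apply: le_trans (enormD_le _ _) _; rewrite enormN lerD.
by rewrite addr_ge0// (le_trans (enorm_ge0 _) (ue _)).
Qed.

End PathGraph.

(** * Quadratic growth of the Lagrangian and smoothness of the dual function *)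

Section DualFunction.
Variables (R : realType) (m n : nat).
Variables (Y : set 'rV[R]_n) (f : 'I_m -> 'rV[R]_n -> R).
Variables (mui : 'I_m -> R) (mu : R).
Hypothesis Yconvex : convex_set Y.
Hypothesis fstrong : forall i, strongly_convex (mui i) (f i).
Hypothesis mu_le : forall i, mu <= mui i.
Hypothesis mu_gt0 : 0 < mu.
Implicit Types (y z : 'M[R]_(m, n)) (lam : 'M[R]_(m.-1, n)).

Lemma Ybar_conv y z (t : R) : 0 <= t <= 1 -> Ybar Y y -> Ybar Y z ->
  Ybar Y (t *: y + (1 - t) *: z).
Proof.
move=> /andP[t0 t1] Yy Yz i.
have := @Yconvex (row i y) (row i z) (Itv01 t0 t1).
by rewrite !inE linearD !linearZ; apply.
Qed.

Lemma lagrangianD lam nu y :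
  lagrangian f (lam + nu) y = lagrangian f lam y + edot nu (Amap y).
Proof. by rewrite /lagrangian edotDl addrA. Qed.

Lemma fsum_conv y z (t : R) : 0 <= t <= 1 ->
  fsum f (t *: y + (1 - t) *: z) <=
    t * fsum f y + (1 - t) * fsum f z - mu / 2 * (t * (1 - t) * edot (y - z) (y - z)).
Proof.
move=> t01; rewrite /fsum edot_rows !mulr_sumr -big_split /= -sumrB.
apply: ler_sum => i _.
have -> : row i (t *: y + (1 - t) *: z) = t *: row i y + (1 - t) *: row i z.
  by rewrite linearD !linearZ.
have -> : row i (y - z) = row i y - row i z by rewrite linearB.
apply: le_trans (strongly_convexW (fstrong i) _ _ t01) _.
set q := t * (1 - t) * _.
have q0 : 0 <= q by rewrite mulr_ge0 ?edot_ge0// mulr_ge0; lra.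
have : mu * q <= mui i * q by rewrite ler_wpM2r.
lra.
Qed.

(** Compare [y] with t z + (1 - t) y, divide by t and let t tend to 0; the constraint term is linear
    and does not affect the convexity defect. *)
Lemma argmin_growth lam y z :
  is_argmin (Ybar Y) (lagrangian f lam) y -> Ybar Y z ->
  lagrangian f lam y + mu / 2 * edot (z - y) (z - y) <= lagrangian f lam z.
Proof.
move=> [Yy ymin] Yz; set q := edot _ _.
have H t : 0 < t < 1 ->
    mu / 2 * ((1 - t) * q) <= lagrangian f lam z - lagrangian f lam y.
  move=> t01; have t01' : 0 <= t <= 1 by lra.
  have := ymin _ (Ybar_conv t01' Yz Yy).
  rewrite {2}/lagrangian AmapD !AmapZ edotDr !edotZr => h.
  have t0 : 0 < t by lra.
  rewrite -(ler_pM2l t0); move: h (fsum_conv z y t01').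
  by rewrite -/q /lagrangian; lra.
have q0 : 0 <= mu / 2 * q by rewrite mulr_ge0 ?edot_ge0// divr_ge0 ?ltW.
rewrite addrC -lerBrDr; apply/ler_addgt0Pl => e e0.
(* Small enough that the loss t (mu/2) q is at most [e]; the added 1 keeps the denominator
   positive. *)
set t := Num.min (1 / 2) (e / (mu / 2 * q + 1)).
have d0 : 0 < mu / 2 * q + 1 by lra.
have tp : 0 < t by rewrite lt_min !divr_gt0//; lra.
have t1 : t <= 1 / 2 by rewrite ge_min lexx.
have : t * (mu / 2 * q + 1) <= e.
  by rewrite -ler_pdivlMr// ge_min lexx orbT.
have := H t; rewrite tp; set a := mu / 2 * q => /(_ ltac:(lra)).
rewrite mulrCA -/a; lra.
Qed.

Hypothesis m_gt1 : (1 < m)%N.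

Lemma cos_pi_ge0 : 0 <= cos (pi / m%:R : R).
Proof.
have m2 : (2 : R) <= m%:R by rewrite ler_nat.
have m0 : 0 < m%:R :> R by lra.
apply: cos_ge0_pihalf; apply/andP; split.
  by have := divr_ge0 (pi_ge0 R) (ltW m0); have := pi_ge0 R; lra.
by rewrite ler_pM2l ?pi_gt0// lef_pV2// posrE.
Qed.

Lemma Lh_gt0 : 0 < Lh m mu.
Proof.
by have := cos_pi_ge0; rewrite /Lh div1r pmulr_rgt0 ?invr_gt0//; lra.
Qed.

Lemma edot_Amap_Lh y : edot (Amap y) (Amap y) <= mu * Lh m mu * edot y y.
Proof.
rewrite /Lh div1r mulrA mulfV ?lt0r_neq0// mul1r.
by apply: Amap_edot_le; rewrite (leq_trans _ m_gt1).
Qed.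

(** Quadratic lower bound for g at [lam + nu], with A y as gradient at [lam]: the growth term
    (mu/2)|z - y|^2 pays for the cross term between [nu] and A(z - y). *)
Lemma dual_descent lam nu y z :
  is_argmin (Ybar Y) (lagrangian f lam) y ->
  is_argmin (Ybar Y) (lagrangian f (lam + nu)) z ->
  lagrangian f lam y + edot nu (Amap y) - Lh m mu / 2 * edot nu nu
    <= lagrangian f (lam + nu) z.
Proof.
move=> ymin [Yz _]; have := argmin_growth ymin Yz.
have := edot_Amap_Lh (z - y); rewrite lagrangianD.
(* Completed square: with |A(z - y)|^2 <= mu L_h |z - y|^2, dividing by 2 L_h bounds the cross term
   from below. *)
have := edot_ge0 (Lh m mu *: nu + Amap (z - y)).
have -> : edot nu (Amap z) = edot nu (Amap y) + edot nu (Amap (z - y)).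
  by rewrite -edotDr -AmapD addrC subrK.
move: (Amap (z - y)) (edot (z - y) (z - y)) => d q.
rewrite !edotE (edotC d nu) => h1 h2 h3.
have L0 := Lh_gt0.
suff : 0 <= Lh m mu * (Lh m mu / 2 * edot nu nu + edot nu d + mu / 2 * q).
  by rewrite pmulr_rge0//; lra.
lra.
Qed.

Lemma edot_Amap_enorm_le lam y :
  `|edot lam (Amap y)| <= enorm lam * (Num.sqrt (mu * Lh m mu) * enorm y).
Proof.
apply: le_trans (edot_le_enorm _ _) _; rewrite ler_wpM2l ?enorm_ge0//.
rewrite /enorm -sqrtrM; first by apply: ler_wsqrtr; exact: edot_Amap_Lh.
by rewrite mulr_ge0 ?ltW ?Lh_gt0.
Qed.

End DualFunction.

(* When [y k] minimizes the Lagrangian at [lam k] and strong duality holds, this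
   is g(lambda_star) - g(lam k), with g the dual function. *)
Definition duality_gap (R : realType) (m n : nat) (f : 'I_m -> 'rV[R]_n -> R)
    (ystar : 'M[R]_(m, n)) (lam : nat -> 'M[R]_(m.-1, n)) (y : nat -> 'M[R]_(m, n))
    (k : nat) : R :=
  fsum f ystar - lagrangian f (lam k) (y k).

(** * Gap estimates along the inexact ascent *)

Section InexactAscent.
Variables (R : realType) (m n : nat).
Variables (Y : set 'rV[R]_n) (f : 'I_m -> 'rV[R]_n -> R).
Variables (mui : 'I_m -> R) (mu : R).
Hypothesis m_gt1 : (1 < m)%N.
Hypothesis Yconvex : convex_set Y.
Hypothesis fstrong : forall i, strongly_convex (mui i) (f i).
Hypothesis mu_le : forall i, mu <= mui i.
Hypothesis mu_gt0 : 0 < mu.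
Variables (ystar : 'M[R]_(m, n)) (lamstar : 'M[R]_(m.-1, n)).
Hypothesis ystar_feas : primal_feasible Y ystar.
Hypothesis strong_duality : (fsum f ystar)%:E = dual_fun Y f lamstar.
Variables (gamma : nat -> R) (r : nat -> 'M[R]_(m, n)).
Variables (lam : nat -> 'M[R]_(m.-1, n)) (y : nat -> 'M[R]_(m, n)).
Hypothesis run : inexact_dual_algorithm Y f gamma r lam y.
Variables (epsilon D : R).
Hypothesis Ar_bound : forall k, enorm (Amap (r k)) <= epsilon.
Hypothesis gamma_bound : forall k, 0 < gamma k <= 1 / Lh m mu.
Hypothesis lam_bound : forall k, enorm (lam k - lamstar) <= D.

Local Notation gap := (duality_gap f ystar lam y).

(** A y_k is a supergradient of g at lam_k: test the infimum defining g(lam_star) with y_k. *)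
Lemma gap_le_edot k : gap k <= edot (lamstar - lam k) (Amap (y k)).
Proof.
rewrite /duality_gap lerBlDl -lagrangianD addrC subrK -lee_fin strong_duality.
by apply: ereal_inf_lbound; exists (y k) => //; case: (run k) => -[].
Qed.

(** As A y_star = 0, every Lagrangian takes the value f(y_star) at y_star; apply quadratic growth
    there. *)
Lemma sqr_dist_le_gap k : mu / 2 * edot (y k - ystar) (y k - ystar) <= gap k.
Proof.
case: (run k) => ymin _; case: ystar_feas => Yys Ays.
have := argmin_growth Yconvex fstrong mu_le mu_gt0 ymin Yys.
rewrite {2}/lagrangian Ays edot0r addr0 /duality_gap lerBrDl.
by rewrite -(opprB (y k)) edotNl edotNr opprK.
Qed.

Lemma gap_ge0 k : 0 <= gap k.
Proof.
by apply: le_trans (sqr_dist_le_gap k); rewrite mulr_ge0 ?edot_ge0// divr_ge0// ltW.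
Qed.

(** The supergradient inequality at lam_k and the descent bound from lam_k to lam_{k+1} combine into
    a difference of squared distances, up to the distortion term. *)
Lemma inexact_step k :
  2 * (gamma k * gap k.+1) <=
    edot (lam k - lamstar) (lam k - lamstar)
    - edot (lam k.+1 - lamstar) (lam k.+1 - lamstar)
    + 2 * (gamma k * (D * epsilon)).
Proof.
have [ymin lamS] := run k; have [yminS _] := run k.+1.
have g0 : 0 < gamma k by case/andP: (gamma_bound k).
have gL : Lh m mu * gamma k <= 1.
  case/andP: (gamma_bound k) => _; rewrite div1r -[_^-1]mul1r ler_pdivlMr ?Lh_gt0//.
  by rewrite mulrC.
(* Pairing the distortion with the new multiplier [lam k.+1] absorbs its quadratic contribution, so
   no epsilon^2 term appears. *)
have errb : - edot (Amap (r k)) (lamstar - lam k.+1) <= D * epsilon.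
  apply: le_trans (ler_norm _) _; rewrite normrN; apply: le_trans (edot_le_enorm _ _) _.
  rewrite mulrC ler_pM ?enorm_ge0 ?Ar_bound//.
  by rewrite -enormN opprB lam_bound.
have hg := gap_le_edot k.
rewrite lamS in yminS.
have hd := dual_descent Yconvex fstrong mu_le mu_gt0 m_gt1 ymin yminS.
rewrite -lamS in hd.
(* The descent bound with nu = gamma_k A(y_k + r_k); L_h gamma_k <= 1 reduces the quadratic
   coefficient to gamma_k / 2. *)
have : gap k.+1 <= edot (lamstar - lam k) (Amap (y k))
   - edot (gamma k *: Amap (y k + r k)) (Amap (y k))
   + gamma k / 2 * edot (Amap (y k + r k)) (Amap (y k + r k)).
  move: hg hd; rewrite /duality_gap !(edotZl, edotZr).
  set dd := edot (Amap (y k + r k)) (Amap (y k + r k)).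
  have dd0 : 0 <= dd by apply: edot_ge0.
  have : 0 <= (1 - Lh m mu * gamma k) * (gamma k * dd).
    by rewrite mulr_ge0 ?subr_ge0// mulr_ge0// ltW.
  by lra.
move=> /(ler_wpM2l (ltW g0)); move: errb => /(ler_wpM2l (ltW g0)).
rewrite lamS AmapD; move: (Amap (y k)) (Amap (r k)) (lam k) => d e l.
rewrite !edotE !(edotC _ d) !(edotC _ e) !(edotC lamstar).
by lra.
Qed.

Lemma D_ge0 : 0 <= D.
Proof. exact: le_trans (enorm_ge0 _) (lam_bound 0). Qed.

Lemma epsilon_ge0 : 0 <= epsilon.
Proof. exact: le_trans (enorm_ge0 _) (Ar_bound 0). Qed.

(** Telescoping sum of [inexact_step]; each stepsize weights the gap at the next multiplier, hence
    the index [i.+1]. *)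
Lemma sum_gap_le k :
  2 * \sum_(0 <= i < k) gamma i * gap i.+1 <= D ^+ 2 + 2 * (series gamma k * (D * epsilon)).
Proof.
apply: (@le_trans _ _ (edot (lam 0 - lamstar) (lam 0 - lamstar)
    - edot (lam k - lamstar) (lam k - lamstar) + 2 * (series gamma k * (D * epsilon)))).
  elim: k => [|k IH]; first by rewrite /series /= !big_geq// subrr; lra.
  rewrite /series /= !big_nat_recr//=; move: IH (inexact_step k).
  by rewrite /series /=; lra.
rewrite lerD2r -sqr_enorm.
have := edot_ge0 (lam k - lamstar); have := lam_bound 0.
by have := enorm_ge0 (lam 0 - lamstar); have := D_ge0; nra.
Qed.

(** The gaps at 1, ..., k have a stepsize-weighted mean at most this bound, so they cannot all
    exceed it. *)
Lemma exists_gap_le k : (0 < k)%N -> exists2 i, (i <= k)%N &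
  gap i <= D * epsilon + D ^+ 2 / (2 * series gamma k).
Proof.
move=> k0; apply: contrapT => H.
have s0 : 0 < series gamma k.
  case: k k0 {H} => // k _; rewrite /series /= big_nat_recl//.
  rewrite ltr_wpDr//; last by case/andP: (gamma_bound 0).
  by apply: sumr_ge0 => i _; case/andP: (gamma_bound i.+1) => /ltW.
set b := D * epsilon + _ in H.
have Hg i : (i <= k)%N -> b < gap i.
  by move=> ik; rewrite ltNge; apply/negP => h; apply: H; exists i.
have : series gamma k * b < \sum_(0 <= i < k) gamma i * gap i.+1.
  rewrite /series /= mulr_suml !big_mkord.
  apply: ltr_sum; first by apply/hasP; exists (Ordinal k0); rewrite ?mem_index_enum.
  by move=> i _; rewrite ltr_pM2l ?Hg//; case/andP: (gamma_bound i).
have := sum_gap_le k; rewrite /b mulrDr.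
have -> : series gamma k * (D ^+ 2 / (2 * series gamma k)) = D ^+ 2 / 2.
  by field; rewrite lt0r_neq0.
lra.
Qed.

Lemma dist_le_gap k : enorm (y k - ystar) <= Num.sqrt (2 / mu * gap k).
Proof.
apply: ler_wsqrtr; rewrite -(ler_pM2l (_ : 0 < mu / 2)) ?divr_gt0//.
apply: le_trans (sqr_dist_le_gap k) _.
by rewrite mulrA [_ / 2 * _](_ : _ = 1) ?mul1r//; field; rewrite lt0r_neq0.
Qed.

(** A y_k = A(y_k - y_star) is controlled by the distance, hence by the root of the gap, and |lam_k|
    <= D + |lam_star|. *)
Lemma norm_edot_le_gap k :
  `|edot (lam k) (Amap (y k))| <=
    (D + enorm lamstar) * Sconst m mu * Num.sqrt (gap k).
Proof.
have -> : Amap (y k) = Amap (y k - ystar).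
  by case: ystar_feas => _ e; rewrite AmapD AmapN e subr0.
apply: le_trans (edot_Amap_enorm_le mu_gt0 m_gt1 _ _) _.
rewrite -mulrA ler_pM ?enorm_ge0 ?mulr_ge0 ?sqrtr_ge0 ?enorm_ge0//.
  have := enormD_le (lam k - lamstar) lamstar; rewrite subrK.
  by have := lam_bound k; lra.
apply: le_trans (ler_wpM2l (sqrtr_ge0 _) (dist_le_gap k)) _.
have c0 := cos_pi_ge0 R m_gt1; have L0 := Lh_gt0 mu_gt0 m_gt1.
rewrite /Sconst -!sqrtrM; first last.
- by rewrite mulr_ge0 ?ltW.
- by rewrite divr_ge0 ?ltW//; lra.
(* Both sides agree because S^2 = 2 L_h. *)
apply: ler_wsqrtr; rewrite /Lh le_eqVlt; apply/orP; left; apply/eqP.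
by field; rewrite lt0r_neq0.
Qed.

Lemma value_le_gap k : fsum f (y k) - fsum f ystar <=
  (D + enorm lamstar) * Sconst m mu * Num.sqrt (gap k).
Proof.
have := gap_ge0 k; rewrite {1}/duality_gap /lagrangian.
have := norm_edot_le_gap k; rewrite -normrN => /(le_trans (ler_norm _)).
lra.
Qed.

Lemma norm_value_le_gap k : `|fsum f (y k) - fsum f ystar| <=
  gap k + (D + enorm lamstar) * Sconst m mu * Num.sqrt (gap k).
Proof.
rewrite ler_norml; apply/andP; split; last first.
  by have := value_le_gap k; have := gap_ge0 k; lra.
have := norm_edot_le_gap k => /(le_trans (ler_norm _)).
rewrite [X in - (X + _)]/duality_gap /lagrangian; lra.
Qed.

End InexactAscent.

(** * Upper limits, partial sums of stepsizes and orders of the rates *)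

Section Rates.
Variable R : realType.
Implicit Types (p g s x : R) (u : nat -> R).

Lemma running_min_le u (k i : nat) : (i <= k)%N -> running_min u k <= u i.
Proof. by move=> ik; exact: (bigmin_le _ (Ordinal (ik : (i < k.+1)%N))). Qed.

(** The upper limit is an infimum over the sets of the filter; the set where u_k <= l + e is one of
    them. *)
Lemma limn_esup_le u (l : R) :
  (forall e, 0 < e -> \forall k \near \oo, u k <= l + e) ->
  (limn_esup (fun k => (u k)%:E) <= l%:E)%E.
Proof.
move=> H; apply/lee_addgt0Pr => e e0.
apply: (@le_trans _ _ (ereal_sup ((fun k => (u k)%:E) @` [set k | u k <= l + e]))).
  by apply: ereal_inf_lbound; exists [set k | u k <= l + e] => //; exact: H.
by apply: ge_ereal_sup => _ [k /= uk <-]; rewrite -EFinD lee_fin.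
Qed.

Lemma sqrtrD_le (a b : R) : 0 <= a -> 0 <= b ->
  Num.sqrt (a + b) <= Num.sqrt a + Num.sqrt b.
Proof.
move=> a0 b0; have sa := sqrtr_ge0 a; have sb := sqrtr_ge0 b.
rewrite -[leRHS]ger0_norm ?addr_ge0// -sqrtr_sqr; apply: ler_wsqrtr.
by rewrite sqrrD !sqr_sqrtr//; have := mulr_ge0 sa sb; lra.
Qed.

Lemma root4_exp x : 0 <= x -> root4 x ^+ 4 = x.
Proof.
by move=> x0; rewrite /root4 -powR_mulrn ?powR_ge0// -powRrM mulVf ?pnatr_eq0// powRr1.
Qed.

Lemma root4_le x s : 0 <= x -> x <= s -> root4 x <= root4 s.
Proof.
by move=> x0 xs; apply: ge0_ler_powR; rewrite ?nnegrE ?invr_ge0//; exact: le_trans xs.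
Qed.

Lemma root4_ge1 s : 1 <= s -> 1 <= root4 s.
Proof. by move=> s1; have := root4_le ler01 s1; rewrite /root4 powR1. Qed.

(** Lower bound, up to the factor [g], for the partial sums of the stepsizes g/(k+1)^p; [rate] is
    its inverse fourth root. *)
Definition growth p (k : nat) : R := if p < 1 then k%:R `^ (1 - p) else ln k%:R.

Lemma rateE p k : rate p k = (root4 (growth p k))^-1 :> R.
Proof. by rewrite /rate /growth; case: ifP; rewrite div1r. Qed.

Lemma growth_ge1 p : 0 <= p <= 1 -> \forall k \near \oo, 1 <= growth p k.
Proof.
move=> /andP[p0 p1]; near=> k.
have ek : expR 1 <= k%:R :> R by near: k; exact: nbhs_infty_ger.
have k1 : 1 <= k%:R :> R by have := expR_ge1Dx (1 : R); lra.
rewrite /growth; case: ifP => p1'.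
  by rewrite -[leLHS](powRr0 k%:R) ler_powR// subr_ge0.
by rewrite -[leLHS]expRK ler_ln ?posrE ?expR_gt0// (lt_le_trans (expR_gt0 _) ek).
Unshelve. all: by end_near. Qed.

Lemma growth_le p k : 0 <= p <= 1 -> (0 < k)%N -> growth p k <= k%:R.
Proof.
move=> /andP[p0 p1] k0; have k1 : 1 <= k%:R :> R by rewrite ler1n.
rewrite /growth; case: ifP => _; last by rewrite ltW// ln_sublinear// ltr0n.
by apply: ler1_powR => //; lra.
Qed.

(** Dominated by 2 k^(1-q) for some q > 0, so it suffices that k^q exceeds 2|C|. For p = 1, q = 1/2
    works, since ln x < x at x = sqrt k gives ln k < 2 sqrt k. *)
Lemma growth_sublinear p (C : R) : 0 < p <= 1 ->
  \forall k \near \oo, C * growth p k < k%:R.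
Proof.
move=> /andP[p0 p1].
pose q := if p < 1 then p else 2^-1.
have q0 : 0 < q by rewrite /q; case: ifP => _; lra.
have gq k : (0 < k)%N -> growth p k <= 2 * k%:R `^ (1 - q).
  move=> k0; rewrite /growth /q; case: ifP => _.
    by have := powR_ge0 k%:R (1 - p); lra.
  have kp : 0 < k%:R :> R by rewrite ltr0n.
  have -> : 1 - 2^-1 = 2^-1 :> R by lra.
  have := ln_sublinear (powR_gt0 2^-1 kp); rewrite ln_powR; lra.
near=> k.
have k0 : (0 < k)%N by near: k; exact: nbhs_infty_gt.
have kp : 0 < k%:R :> R by rewrite ltr0n.
have kq : 2 * `|C| < k%:R `^ q.
  have : (2 * `|C| + 1) `^ q^-1 <= k%:R by near: k; exact: nbhs_infty_ger.
  have c0 : 0 <= 2 * `|C| + 1 by have := normr_ge0 C; lra.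
  move=> /(ge0_ler_powR (ltW q0)); rewrite !nnegrE powR_ge0 ler0n => /(_ isT isT).
  by rewrite -powRrM mulVf ?lt0r_neq0// powRr1//; lra.
have -> : k%:R = k%:R `^ q * k%:R `^ (1 - q).
  by rewrite -powRD ?lt0r_neq0 ?implybT// addrC subrK powRr1// ltW.
have P0 : 0 < k%:R `^ (1 - q) by rewrite powR_gt0.
apply: (@le_lt_trans _ _ (`|C| * (2 * k%:R `^ (1 - q)))).
  apply: (@le_trans _ _ (`|C| * `|growth p k|)); first by rewrite -normrM ler_norm.
  rewrite ler_wpM2l// ger0_norm ?gq//.
  rewrite /growth; case: ifP => _; first exact: powR_ge0.
  by rewrite ln_ge0// ler1n.
by rewrite mulrCA mulrA ltr_pM2r.
Unshelve. all: by end_near. Qed.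

(** Each increment is ln(1 + 1/(k+1)) <= 1/(k+1). *)
Lemma ln_le_harmonic (k : nat) : ln k.+1%:R <= \sum_(0 <= i < k) i.+1%:R^-1 :> R.
Proof.
elim: k => [|k IH]; first by rewrite ln1 big_geq.
rewrite big_nat_recr//=; have k0 : 0 < k.+1%:R :> R by rewrite ltr0n.
have -> : k.+2%:R = k.+1%:R * (1 + k.+1%:R^-1) :> R.
  by rewrite mulrDr mulr1 mulfV ?lt0r_neq0// natr1.
have i0 : 0 < k.+1%:R^-1 :> R by rewrite invr_gt0.
rewrite lnM ?posrE ?addr_gt0//.
by apply: lerD => //; apply: le_ln1Dx; rewrite (lt_trans _ i0)// ltrN10.
Qed.

(** For p < 1 each of the k terms is at least g/k^p; for p = 1 the sum is harmonic. *)
Lemma growth_le_series p g (gamma : nat -> R) : 0 <= p <= 1 -> 0 < g ->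
  (forall k, gamma k = g / k.+1%:R `^ p) ->
  forall k, (0 < k)%N -> g * growth p k <= series gamma k.
Proof.
move=> /andP[p0 p1] g0 gE k k0; rewrite /growth /series /=; case: ifP => p1'.
  have kp : 0 < k%:R :> R by rewrite ltr0n.
  rewrite powRB ?(lt0r_neq0 kp) ?implybT// powRr1 ?ler0n//.
  have -> : g * (k%:R / k%:R `^ p) = \sum_(0 <= i < k) (g / k%:R `^ p).
    by rewrite sumr_const_nat subn0 -[RHS]mulr_natl; ring.
  apply: ler_sum_nat => i /andP[_ ik]; rewrite gE ler_pM2l//.
  rewrite lef_pV2 ?posrE ?powR_gt0 ?ltr0n//.
  by apply: ge0_ler_powR; rewrite ?nnegrE ?ler0n// ler_nat.
have pE : p = 1 by apply/le_anti; rewrite p1 leNgt p1'.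
apply: (@le_trans _ _ (g * \sum_(0 <= i < k) i.+1%:R^-1)).
  rewrite ler_pM2l//; apply: le_trans (ln_le_harmonic k).
  by rewrite ler_ln ?posrE ?ltr0n// ler_nat.
by rewrite mulr_sumr; apply: ler_sum => i _; rewrite gE pE powRr1 ?ler0n.
Qed.

Lemma rate_ge0 p k : 0 <= rate p k.
Proof. by rewrite rateE invr_ge0 powR_ge0. Qed.

Lemma rate_le1 p : 0 <= p <= 1 -> \forall k \near \oo, rate p k <= 1.
Proof.
move=> p01; apply: filterS (growth_ge1 p01) => k /root4_ge1 s1.
by rewrite rateE invf_le1// (lt_le_trans ltr01).
Qed.

(** The left side is rate^4 and rate <= 1. The square is what the later square root of the gap turns
    into the rate itself. *)
Lemma inv_growth_le p : 0 <= p <= 1 ->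
  \forall k \near \oo, (growth p k)^-1 <= rate p k ^+ 2.
Proof.
move=> p01; apply: filterS (growth_ge1 p01) => k s1.
have r1 := root4_ge1 s1; have r0 := lt_le_trans ltr01 r1.
rewrite rateE -[X in X^-1 <= _]root4_exp ?(le_trans ler01)//.
rewrite exprVn lef_pV2 ?posrE ?exprn_gt0//.
by rewrite ler_weXn2l.
Qed.

Lemma best_order : best_order_at_0 R.
Proof.
move=> p p01; split.
  apply/eqO_exP; exists 1 => //; near=> k.
  have k0 : (0 < k)%N by near: k; exact: nbhs_infty_gt.
  have s1 : 1 <= growth p k by near: k; exact: growth_ge1.
  have r1 := root4_ge1 s1; have r0 := lt_le_trans ltr01 r1.
  have le4 : root4 (growth p k) <= root4 k%:R.
    by apply: root4_le (growth_le p01 k0); rewrite (le_trans ler01).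
  have k4 := lt_le_trans r0 le4.
  rewrite rateE /quartic_rate div1r mul1r !ger0_norm ?invr_ge0 ?powR_ge0//.
  by rewrite lef_pV2 ?posrE.
split=> [/eqO_exP[C C0 H]|->]; last first.
  apply/eqO_exP; exists 1 => //; near=> k.
  by rewrite rateE /growth ltr01 subr0 powRr1 ?ler0n// /quartic_rate div1r mul1r.
(* For p > 0 the O-bound, raised to the fourth power, would give k <= C^4 [growth p k] for large k,
   against sublinearity. *)
apply/eqP; apply: contrapT => /negP pn0.
have pp : 0 < p <= 1 by case/andP: p01 => p0 ->; rewrite lt_def pn0 p0.
have [k [Hk [s1 [k0 sub]]]] : exists k, `|rate p k| <= C * `|quartic_rate R k| /\
    1 <= growth p k /\ (0 < k)%N /\ C ^+ 4 * growth p k < k%:R.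
  near \oo => k; exists k; split; first by near: k.
  split; first by near: k; exact: growth_ge1.
  split; first by near: k; exact: nbhs_infty_gt.
  by near: k; exact: growth_sublinear.
have r1 := root4_ge1 s1; have r0 := lt_le_trans ltr01 r1.
have k4 : 0 < root4 (k%:R : R) by apply: powR_gt0; rewrite ltr0n.
move: Hk; rewrite rateE /quartic_rate div1r !ger0_norm ?invr_ge0 ?powR_ge0//.
rewrite ler_pdivlMr// mulrC -ler_pdivlMr ?invr_gt0// invrK => Hk.
have : root4 (k%:R : R) ^+ 4 <= (C * root4 (growth p k)) ^+ 4.
  by apply: lerXn2r => //; rewrite nnegrE ltW// mulr_gt0.
rewrite exprMn !root4_exp ?ler0n ?(le_trans ler01)//.
by rewrite leNgt sub.
Unshelve. all: by end_near. Qed.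

End Rates.

(** * From the gap estimate to the limits and the rates *)

Theorem mainTheorem1 (R : realType) (m n : nat)
  (hm : (2 <= m)%N) (hn : (1 <= n)%N)
  (Y : set 'rV[R]_n) (Yclosed : closed Y) (Yconvex : convex_set Y)
  (f : 'I_m -> 'rV[R]_n -> R)
  (fstrict : forall i, strictly_convex (f i))
  (fclosed : forall i, closed_function (f i))
  (mui : 'I_m -> R)
  (fstrong : forall i, strongly_convex (mui i) (f i))
  (fdiff : forall i x, differentiable (f i : 'rV[R]_n -> R^o) x)
  (ystar : 'M[R]_(m, n)) (lamstar : 'M[R]_(m.-1, n))
  (primal_att : primal_optimal Y f ystar)
  (dual_att : dual_optimal Y f lamstar)
  (strong_duality : (fsum f ystar)%:E = dual_fun Y f lamstar)
  (mu : R) (mu_def : mu = mu_min hm mui)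
  (gamma : nat -> R) (r : nat -> 'M[R]_(m, n))
  (lam : nat -> 'M[R]_(m.-1, n)) (y : nat -> 'M[R]_(m, n))
  (run : inexact_dual_algorithm Y f gamma r lam y)
  (eps : 'I_m -> R)
  (r_bound : forall i k, enorm (row i (r k)) <= eps i)
  (gamma_bound : forall k, 0 < gamma k <= 1 / Lh m mu)
  (gamma_div : series gamma @ \oo --> +oo)
  (D : R) (lam_bound : forall k, enorm (lam k - lamstar) <= D)
  (epsilon : R) (epsilon_def : epsilon = total_eps eps) :
  [/\ (limn_esup (fun k =>
         (running_min (fun i => enorm (y i - ystar)) k)%:E)
       <= (Num.sqrt (2 * D * epsilon / mu))%:E)%E,
      (limn_esup (fun k =>
         (running_min (fun i => (fsum f (y i) - fsum f ystar)%R) k)%:E)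
       <= (D * epsilon
           + Num.sqrt D * Sconst m mu * (D + enorm lamstar)
             * Num.sqrt epsilon)%:E)%E,
      (forall g p : R,
         0 < g <= 1 / Lh m mu -> 0 <= p <= 1 ->
         (forall k, gamma k = g / k.+1%:R `^ p) ->
         exists C : R, \forall k \near \oo,
           running_min (fun i => enorm (y i - ystar)) k
           <= C * rate p k + Num.sqrt (2 * D * epsilon / mu))
      /\ best_order_at_0 R
    & (forall g p : R,
         0 < g <= 1 / Lh m mu -> 0 <= p <= 1 ->
         (forall k, gamma k = g / k.+1%:R `^ p) ->
         exists C : R, \forall k \near \oo,
           running_min (fun i => `|fsum f (y i) - fsum f ystar|) k
           <= C * rate p k
              + (D * epsilon
                 + Num.sqrt D * Sconst m mu * (D + enorm lamstar)
                   * Num.sqrt epsilon))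
      /\ best_order_at_0 R ].
Proof.
have mui_gt0 i : 0 < mui i by case: (fstrong i).
have mu_gt0 : 0 < mu by rewrite mu_def; apply: lt_bigmin.
have mu_le i : mu <= mui i by rewrite mu_def; apply: bigmin_le.
case: primal_att => ystar_feas _.
have Ar_bound k : enorm (Amap (r k)) <= epsilon.
  by rewrite epsilon_def; apply: Amap_enorm_le.
have D0 := D_ge0 lam_bound; have e0 := epsilon_ge0 Ar_bound.
set gap := duality_gap f ystar lam y.
have gap_min k : (0 < k)%N -> exists2 i, (i <= k)%N &
    gap i <= D * epsilon + D ^+ 2 / (2 * series gamma k).
  exact: (exists_gap_le hm Yconvex fstrong mu_le mu_gt0 strong_duality run).
have dist_le k : enorm (y k - ystar) <= Num.sqrt (2 / mu * gap k).
  exact: (dist_le_gap Yconvex fstrong mu_le mu_gt0 ystar_feas run).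
set M := (D + enorm lamstar) * Sconst m mu.
have M0 : 0 <= M by rewrite mulr_ge0 ?sqrtr_ge0// addr_ge0 ?enorm_ge0.
have value_le k : fsum f (y k) - fsum f ystar <= M * Num.sqrt (gap k).
  exact: (value_le_gap hm Yconvex fstrong mu_le mu_gt0 ystar_feas run).
have norm_value_le k : `|fsum f (y k) - fsum f ystar| <= gap k + M * Num.sqrt (gap k).
  exact: (norm_value_le_gap hm Yconvex fstrong mu_le mu_gt0 ystar_feas run).
have a0 : 0 <= D * epsilon by rewrite mulr_ge0.
have -> : 2 * D * epsilon / mu = 2 / mu * (D * epsilon) by ring.
have -> : Num.sqrt D * Sconst m mu * (D + enorm lamstar) * Num.sqrt epsilon =
    M * Num.sqrt (D * epsilon) by rewrite sqrtrM// /M; ring.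
move: (D * epsilon) a0 gap_min => a a0 gap_min.
have mu2 : 0 < 2 / mu by rewrite divr_gt0.
(* Subadditivity of the square root separates the error floor from the vanishing part [t]. *)
have dist_bound i t : 0 <= t -> gap i <= a + t ->
    enorm (y i - ystar) <= Num.sqrt (2 / mu * a) + Num.sqrt (2 / mu * t).
  move=> t0 git; apply: le_trans (dist_le i) _.
  have c0 x : 0 <= x -> 0 <= 2 / mu * x by move=> x0; rewrite mulr_ge0// ltW.
  apply: le_trans (sqrtrD_le (c0 _ a0) (c0 _ t0)).
  by apply: ler_wsqrtr; rewrite -mulrDr ler_pM2l.
have M_bound i t : 0 <= t -> gap i <= a + t ->
    M * Num.sqrt (gap i) <= M * Num.sqrt a + M * Num.sqrt t.
  move=> t0 git; rewrite -mulrDr ler_wpM2l//.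
  by apply: le_trans (sqrtrD_le a0 t0); apply: ler_wsqrtr.
have near_gap t : 0 < t -> \forall k \near \oo, exists2 i, (i <= k)%N & gap i <= a + t.
  move=> t0; near=> k.
  have k0 : (0 < k)%N by near: k; exact: nbhs_infty_gt.
  have [i ik gi] := gap_min k k0; exists i => //; apply: le_trans gi _.
  (* Divergence of the stepsize sum enters here; the added 1 keeps the threshold positive when D =
     0. *)
  have sk : (D ^+ 2 + 1) / (2 * t) <= series gamma k.
    by near: k; move/cvgryPge: gamma_div; apply.
  have t2 : 0 < 2 * t by rewrite mulr_gt0.
  have d2 := sqr_ge0 D.
  have s0 : 0 < series gamma k.
    by apply: lt_le_trans sk; rewrite divr_gt0//; lra.
  rewrite lerD2l ler_pdivrMr ?mulr_gt0//.
  by move: sk; rewrite ler_pdivrMr//; lra.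
have rate_gap g p : 0 < g <= 1 / Lh m mu -> 0 <= p <= 1 ->
    (forall k, gamma k = g / k.+1%:R `^ p) ->
    \forall k \near \oo, exists2 i, (i <= k)%N &
      gap i <= a + D ^+ 2 / (2 * g) * rate p k ^+ 2.
  move=> /andP[g0 _] p01 gE; near=> k.
  have k0 : (0 < k)%N by near: k; exact: nbhs_infty_gt.
  have [i ik gi] := gap_min k k0; exists i => //; apply: le_trans gi _.
  have s1 : 1 <= growth p k by near: k; exact: growth_ge1.
  have s0 := lt_le_trans ltr01 s1.
  have hs := growth_le_series p01 g0 gE k0.
  have S0 : 0 < series gamma k by apply: lt_le_trans hs; rewrite mulr_gt0.
  have hr : (growth p k)^-1 <= rate p k ^+ 2 by near: k; exact: inv_growth_le.
  rewrite lerD2l; apply: (@le_trans _ _ (D ^+ 2 / (2 * g) * (growth p k)^-1)).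
    rewrite -mulrA -invfM ler_wpM2l ?sqr_ge0// lef_pV2 ?posrE ?mulr_gt0//.
    by rewrite -mulrA ler_pM2l.
  by rewrite ler_wpM2l// divr_ge0 ?sqr_ge0// mulr_ge0// ltW.
split.
- apply: limn_esup_le => e ep.
  (* Chosen so that the square root of (2/mu) t is exactly [e]. *)
  have t0 : 0 < mu / 2 * e ^+ 2 by rewrite mulr_gt0 ?divr_gt0 ?exprn_gt0.
  apply: filterS (near_gap _ t0) => k [i ik gi].
  apply: le_trans (running_min_le _ ik) _.
  apply: le_trans (dist_bound _ _ (ltW t0) gi) _.
  have -> : 2 / mu * (mu / 2 * e ^+ 2) = e ^+ 2 by field; rewrite lt0r_neq0.
  by rewrite sqrtr_sqr ger0_norm// ltW.
- apply: limn_esup_le => e ep.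
  have M1 : 0 < M + 1 by lra.
  (* Chosen so that M sqrt(t) <= e, also when M = 0. *)
  have t0 : 0 < (e / (M + 1)) ^+ 2 by rewrite exprn_gt0// divr_gt0.
  apply: filterS (near_gap _ t0) => k [i ik gi].
  apply: le_trans (running_min_le _ ik) _.
  apply: le_trans (value_le i) _.
  apply: le_trans (M_bound _ _ (ltW t0) gi) _.
  rewrite sqrtr_sqr ger0_norm ?divr_ge0 ?(ltW ep) ?(ltW M1)//.
  have : M * (e / (M + 1)) <= e.
    by rewrite mulrA ler_pdivrMr//; nra.
  lra.
- split; last exact: best_order.
  move=> g p hg p01 gE; set b := D ^+ 2 / (2 * g).
  have b0 : 0 <= b.
    by case/andP: hg => g0 _; rewrite divr_ge0 ?sqr_ge0// mulr_ge0// ltW.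
  exists (Num.sqrt (2 / mu * b)).
  apply: filterS (rate_gap g p hg p01 gE) => k [i ik gi].
  apply: le_trans (running_min_le _ ik) _.
  apply: le_trans (dist_bound _ _ _ gi) _; first by rewrite mulr_ge0 ?sqr_ge0.
  rewrite addrC lerD2r mulrA sqrtrM; last by rewrite mulr_ge0// ltW.
  by rewrite sqrtr_sqr ger0_norm ?rate_ge0.
- split; last exact: best_order.
  move=> g p hg p01 gE; set b := D ^+ 2 / (2 * g).
  have b0 : 0 <= b.
    by case/andP: hg => g0 _; rewrite divr_ge0 ?sqr_ge0// mulr_ge0// ltW.
  (* [b] comes from the gap itself, using rate^2 <= rate; the other summand comes from its square
     root. *)
  exists (b + M * Num.sqrt b).
  near=> k.
  have [i ik gi] : exists2 i, (i <= k)%N & gap i <= a + b * rate p k ^+ 2.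
    by near: k; exact: rate_gap.
  have h1 : rate p k <= 1 by near: k; exact: rate_le1.
  have h0 : 0 <= rate p k := rate_ge0 p k.
  apply: le_trans (running_min_le _ ik) _.
  apply: le_trans (norm_value_le i) _.
  have t0 : 0 <= b * rate p k ^+ 2 by rewrite mulr_ge0 ?sqr_ge0.
  have := M_bound _ _ t0 gi.
  rewrite sqrtrM// sqrtr_sqr (ger0_norm h0).
  have : b * rate p k ^+ 2 <= b * rate p k.
    by rewrite ler_wpM2l// expr2 ler_piMr.
  by move: gi; lra.
Unshelve. all: by end_near. Qed.
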